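(* For the path $P_n$ on $n$ vertices, we have $c_k(P_n)=n-1$ for $n\leq k+1$ and $c_k(P_n)=n$ otherwise, for every $k\geq 3$.
   Context: All graphs are simple. Let $G$ be a graph and $k\in\{2,3,\dots\}$. A multiset $\mathscr{P}$ of paths in $G$ is a $k$-rainbow separating path system ($k$-RSPS) if its elements can be colored with $k$ colors so that for every pair of distinct edges $e_1,e_2\in E(G)$ there exist paths $P_1,P_2\in\mathscr{P}$ of distinct colors such that $P_1$ contains $e_1$ but not $e_2$, and $P_2$ contains $e_2$ but not $e_1$. The $k$-rainbow separation number $c_k(G)$ is the smallest cardinality of a $k$-RSPS of $G$.
   Formalization: The case n = 2 is excluded: P_2 has only one edge, so the empty multiset is vacuously a k-RSPS and c_k(P_2) = 0, not n − 1 = 1. *)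

(* Defs.v *)
From mathcomp Require Import all_boot.
From mathcomp Require Import boolp.

Set Implicit Arguments.
Unset Strict Implicit.
Unset Printing Implicit Defensive.

(* finite simple graphs *)
Record sgraph := SGraph {
  vertex :> finType;
  adj : rel vertex;
  adj_sym : symmetric adj;
  adj_irr : irreflexive adj
}.

Definition edges (G : sgraph) : {set {set G}} :=
  [set [set xy.1; xy.2] | xy : G * G & adj xy.1 xy.2].

(* A path of G, given by its (distinct) vertices in the order of a traversal.
   The two traversals of a path are different terms with the same edges; this
   is harmless below, where paths occur in multisets and only their edges are
   used. Single-vertex paths are allowed. *)
Record gpath (G : sgraph) := GPath {
  gpath_start : G;
  gpath_rest : seq G;
  gpath_adj : path (@adj G) gpath_start gpath_rest;
  gpath_uniq : uniq (gpath_start :: gpath_rest)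
}.

Definition gpath_edges (G : sgraph) (p : gpath G) : seq {set G} :=
  pairmap (fun x y => [set x; y]) (gpath_start p) (gpath_rest p).

(* A multiset of m paths is listed as an m-tuple; the coloring is defined on
   positions, so that several copies of a path may get different colors. *)
Definition is_RSPS (k : nat) (G : sgraph) (m : nat) (P : m.-tuple (gpath G)) :=
  exists c : 'I_m -> 'I_k,
    forall e1 e2 : {set G}, e1 \in edges G -> e2 \in edges G -> e1 != e2 ->
    exists i1 i2 : 'I_m,
      [/\ c i1 != c i2,
          e1 \in gpath_edges (tnth P i1) /\ e2 \notin gpath_edges (tnth P i1)
        & e2 \in gpath_edges (tnth P i2) /\ e1 \notin gpath_edges (tnth P i2)].

Definition has_RSPS (k : nat) (G : sgraph) (m : nat) :=
  exists P : m.-tuple (gpath G), is_RSPS k P.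

Lemma has_RSPS_exists (k : nat) (G : sgraph) :
  1 < k -> exists m, `[< has_RSPS k G m >].
Proof.
move=> k1; pose A := {xy : G * G | adj xy.1 xy.2}.
have pth (a : A) : path (@adj G) (val a).1 [:: (val a).2].
  by rewrite /= (valP a).
have unq (a : A) : uniq [:: (val a).1; (val a).2].
  rewrite /= inE andbT; apply/eqP => E.
  by have := valP a; rewrite /= E adj_irr.
pose I : finType := (A * 'I_k)%type.
exists #|I|; apply/asboolP.
exists [tuple GPath (pth (enum_val i : I).1) (unq (enum_val i : I).1) | i < #|I|].
exists (fun i => (enum_val i : I).2) => e1 e2.
case/imsetP => p1; rewrite inE => a1 ->; case/imsetP => p2; rewrite inE => a2 -> ne.
exists (enum_rank ((exist _ p1 a1, Ordinal (ltnW k1)) : I)).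
exists (enum_rank ((exist _ p2 a2, Ordinal k1) : I)).
rewrite !tnth_mktuple !enum_rankK /gpath_edges /= !inE !eqxx.
by rewrite (eq_sym [set p2.1; _]) ne.
Qed.

(* c_k(G), for k >= 2 *)
Definition rainbow_sepnum (k : nat) (hk : 1 < k) (G : sgraph) : nat :=
  ex_minn (has_RSPS_exists G hk).

Definition path_rel (n : nat) : rel 'I_n :=
  fun i j => (i.+1 == j :> nat) || (j.+1 == i :> nat).

Lemma path_rel_sym n : symmetric (@path_rel n).
Proof. by move=> i j; rewrite /path_rel orbC. Qed.

Lemma path_rel_irr n : irreflexive (@path_rel n).
Proof. by move=> i; rewrite /path_rel orbb eqn_leq ltnn. Qed.

(* P_n *)
Definition path_graph (n : nat) : sgraph :=
  SGraph (@path_rel_sym n) (@path_rel_irr n).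

(* Main.v *)
Require Import Defs.
From mathcomp Require Import all_boot.
From mathcomp Require Import boolp.
From mathcomp Require Import zify.

Set Implicit Arguments.
Unset Strict Implicit.
Unset Printing Implicit Defensive.

(** Write [N = n - 1] for the number of edges of [P_n]. They are linearly
    ordered, and a path of [P_n] contains a set of consecutive edges.

    Lower bounds. Suppose that [N >= 2] and that an RSPS is given. Separating
    edge [i] from edge [i + 1] provides a path whose last edge is [i], and
    separating it from edge [i - 1] a path whose first edge is [i]; at the two
    ends of [P_n] it is enough to cover the extreme edge. Paths obtained for
    different [i] are different, hence there are at least [N] of them
    ([leq_card_separating]). If there are exactly [N], both assignments are
    bijections, so matching the first edge of each path with its last edge
    is a permutation [s] of the edges with [i <= s i]. Only the identity has
    this property ([inj_geq_id]), so that every path is a single edge. Then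
    each edge lies in one path only, rainbow separation forces all colors to
    be distinct, and [N <= k] ([separating_tight]).

    Upper bounds. If [N <= k], take the [N] single edges in distinct colors.
    In general take, for each of the [n] vertices [v], the path made of the
    edges at [v], with color [v] mod 3. Two edges with no common vertex lie
    on four different paths, in two colors for each edge, so that different
    colors can be chosen; for consecutive edges [uv] and [vw] the paths of
    [u] and [w] have different colors. *)

(** * Edges and walks of a path graph *)

Section PathGraph.
Variable N : nat.
Notation G := (path_graph N.+1).
Implicit Types (i j l a : nat) (x : 'I_N.+1) (s : seq 'I_N.+1) (p : gpath G).

Definition pedge i : {set G} := [set (inord i : 'I_N.+1); (inord i.+1 : 'I_N.+1)].

Definition walk_edges x s : seq {set G} := pairmap (fun y z => [set y; z]) x s.

Lemma inord_eq i j : i <= N -> j <= N ->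
  ((inord i : 'I_N.+1) == inord j) = (i == j).
Proof. by move=> iN jN; rewrite -val_eqE /= !inordK. Qed.

Lemma pedge_inj i j : i < N -> j < N -> pedge i = pedge j -> i = j.
Proof.
move=> iN jN E.
have : (inord i : 'I_N.+1) \in pedge j by rewrite -E !inE eqxx.
have : (inord j : 'I_N.+1) \in pedge i by rewrite E !inE eqxx.
rewrite !inE !inord_eq; lia.
Qed.

Lemma pedge_of_adj x y : path_rel x y ->
  exists2 i, i < N & [set x; y] = pedge i /\ (minn x y = i /\ maxn x y = i.+1).
Proof.
have ltx := ltn_ord x; have lty := ltn_ord y.
case/orP => /eqP E; [exists x | exists y]; try lia; split; try lia.
  by rewrite /pedge E !inord_val.
by rewrite /pedge E !inord_val setUC.
Qed.

Lemma pedge_in_edges i : i < N -> pedge i \in edges G.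
Proof.
move=> iN; apply/imsetP; exists (inord i, inord i.+1) => //.
by rewrite inE /= /path_rel !inordK ?eqxx //; lia.
Qed.

Lemma edgesP (e : {set G}) : e \in edges G -> exists2 i, i < N & e = pedge i.
Proof.
case/imsetP => -[x y]; rewrite inE /= => /pedge_of_adj [i iN [-> _]] ->.
by exists i.
Qed.

(** The only edge joining the vertices up to [l] to the others is [l]. *)
Lemma walk_avoids l x s : l < N -> path (@path_rel N.+1) x s ->
  pedge l \notin walk_edges x s ->
  forall y, y \in x :: s -> (y <= l) = (x <= l).
Proof.
move=> lN; elim: s x => [|z s IHs] x /=.
  by move=> _ _ y; rewrite inE => /eqP ->.
case/andP => /pedge_of_adj [i iN [E [mi ma]]] pth.
rewrite inE negb_or E => /andP[nE nin] y.
have side : (z <= l) = (x <= l).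
  have ne : l != i by apply: contraNneq nE => ->.
  lia.
by rewrite inE => /predU1P[-> //|/(IHs _ pth nin) ->].
Qed.

Lemma walk_edges_mem e x s (y : 'I_N.+1) :
  e \in walk_edges x s -> y \in e -> y \in x :: s.
Proof.
elim: s x => [|z s IHs] x //=; rewrite inE => /predU1P[-> | es].
  by rewrite !inE => /orP[] ->; rewrite ?orbT.
by move=> /(IHs _ es) ys; rewrite inE ys orbT.
Qed.

(** If [l] were missing, the path would stay on one side of it, but
    edges [i] and [j] are on different sides. *)
Lemma gpath_edges_convex p i l j : i <= l <= j -> j < N ->
  pedge i \in gpath_edges p -> pedge j \in gpath_edges p ->
  pedge l \in gpath_edges p.
Proof.
case: p => x s pth un; rewrite /gpath_edges /= => ilj jN iP jP.
apply/negPn/negP => lP.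
have lN : l < N by lia.
have side := walk_avoids lN pth lP.
have := side _ (walk_edges_mem (y := inord i) iP _).
have := side _ (walk_edges_mem (y := inord j.+1) jP _).
by rewrite !inE !eqxx ?orbT !inordK; lia.
Qed.

Lemma walk_edges_iota a l :
  walk_edges (inord a) [seq inord i | i <- iota a.+1 l] = map pedge (iota a l).
Proof. by elim: l a => //= l IHl a; rewrite -IHl. Qed.

Lemma path_iota a l : a + l <= N ->
  path (@path_rel N.+1) (inord a) [seq inord i | i <- iota a.+1 l].
Proof.
elim: l a => //= l IHl a alN; apply/andP; split; last by apply: IHl; lia.
by rewrite /path_rel !inordK ?eqxx //; lia.
Qed.

Lemma uniq_iota a l : a + l <= N ->
  uniq ((inord a : 'I_N.+1) :: [seq inord i | i <- iota a.+1 l]).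
Proof.
move=> alN; rewrite -[_ :: _]/(map inord (iota a l.+1)) map_inj_in_uniq ?iota_uniq //.
move=> i j; rewrite !mem_iota => ia ja /eqP.
by rewrite inord_eq => [/eqP||]; lia.
Qed.

Definition interval_gpath a l (alN : a + l <= N) : gpath G :=
  @GPath G _ _ (path_iota alN) (uniq_iota alN).

Lemma pedge_in_interval a l (alN : a + l <= N) i : i < N ->
  (pedge i \in gpath_edges (interval_gpath alN)) = (a <= i < a + l).
Proof.
move=> iN; rewrite [gpath_edges _]walk_edges_iota -mem_iota.
apply/mapP/idP => [[j]|ia]; last by exists i.
by rewrite mem_iota => ja /pedge_inj ->; rewrite ?mem_iota //; lia.
Qed.

(** * Separating systems as families of sets of edge numbers *)

Definition rainbow_separating (T : Type) (C : eqType) (S : T -> pred nat) (c : T -> C) :=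
  forall i j, i < N -> j < N -> i != j ->
  exists t u, [/\ c t != c u, S t i /\ ~~ S t j & S u j /\ ~~ S u i].

Lemma is_RSPSP k m (P : m.-tuple (gpath G)) :
  is_RSPS k P <-> exists c : 'I_m -> 'I_k,
    rainbow_separating (fun t i => pedge i \in gpath_edges (tnth P t)) c.
Proof.
split=> -[c sep]; exists c.
  move=> i j iN jN ij; apply: sep; rewrite ?pedge_in_edges //.
  by apply: contraNneq ij => /pedge_inj ->.
move=> e1 e2 /edgesP[i iN ->] /edgesP[j jN ->] ne.
by apply: sep => //; apply: contraNneq ne => ->.
Qed.

(** * Lower bounds *)

Lemma inj_geq_id (s : 'I_N -> 'I_N) :
  injective s -> (forall i : 'I_N, i <= s i) -> s =1 id.
Proof.
move=> s_inj s_ge i.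
(* A permutation preserves the sum of all [i]. *)
have sum_eq : \sum_(i < N) i == \sum_(i < N) s i.
  by rewrite [X in X == _](reindex_inj s_inj).
have le (i' : 'I_N) : true -> i' <= s i' ?= iff (i' == s i' :> nat) by move=> _; split.
have [_] := leqif_sum le; rewrite sum_eq => /esym/forall_inP/(_ i isT)/eqP E.
exact/esym/val_inj.
Qed.

Section Separating.
Variables (m : nat) (C : finType) (S : 'I_m -> pred nat) (c : 'I_m -> C).
Hypothesis N2 : 1 < N.
Hypothesis convS : forall t i l j, i <= l <= j -> j < N -> S t i -> S t j -> S t l.
Hypothesis sepS : rainbow_separating S c.

Definition last_edge (t : 'I_m) i := S t i /\ forall j, j < N -> S t j -> j <= i.
Definition first_edge (t : 'I_m) i := S t i /\ forall j, j < N -> S t j -> i <= j.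

(** Convexity makes [i] the last edge of a path that contains [i] but not
    [i + 1]; the last edge of the whole graph only has to be covered. *)
Lemma exists_last_edge (i : 'I_N) : exists t, last_edge t i.
Proof.
have iN := ltn_ord i.
have [iN1|iN1] := ltnP i.+1 N; last first.
  have [||t [_ [_ [ti _] _]]] := sepS iN (j := i.-1); try lia.
  by exists t; split=> // j; lia.
have [|t [_ [_ [ti nti] _]]] := sepS iN iN1; first by lia.
exists t; split=> // j jN tj; rewrite leqNgt; apply: contraNN nti => ij.
by apply: convS ti tj => //; lia.
Qed.

Lemma exists_first_edge (i : 'I_N) : exists t, first_edge t i.
Proof.
have iN := ltn_ord i.
have [i0|i0] := posnP i.
  have [||t [_ [_ [ti _] _]]] := sepS iN (j := 1); try lia.
  by exists t; split=> // j; lia.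
have [||t [_ [_ [ti nti] _]]] := sepS iN (j := i.-1); try lia.
exists t; split=> // j jN tj; rewrite leqNgt; apply: contraNN nti => ij.
by apply: convS tj ti => //; lia.
Qed.

Lemma last_edge_inj (r : 'I_N -> 'I_m) :
  (forall i : 'I_N, last_edge (r i) i) -> injective r.
Proof.
move=> rP i j E; apply/val_inj/anti_leq.
have [ri /(_ j (ltn_ord j)) ij] := rP i; have [rj /(_ i (ltn_ord i)) ji] := rP j.
by rewrite ji -?E // ij // E.
Qed.

Lemma first_edge_inj (r : 'I_N -> 'I_m) :
  (forall i : 'I_N, first_edge (r i) i) -> injective r.
Proof.
move=> rP i j E; apply/val_inj/anti_leq.
have [ri /(_ j (ltn_ord j)) ij] := rP i; have [rj /(_ i (ltn_ord i)) ji] := rP j.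
by rewrite ij ?ji // ?E // -E.
Qed.

Lemma leq_card_separating : N <= m.
Proof.
have [r rP] := choice exists_last_edge.
by have := leq_card _ (last_edge_inj rP); rewrite !card_ord.
Qed.

(** With [r i] the path ending at edge [i] and [f i] the path starting there,
    both bijective, [r^-1 \o f] never decreases an edge number and is thus the
    identity. So [r i = f i] is the single edge [i], the only path through [i],
    and two paths [r i] and [r j] can separate only if their colors differ. *)
Lemma separating_tight : m = N -> N <= #|C|.
Proof.
move=> mN.
have [r rP] := choice exists_last_edge; have [f fP] := choice exists_first_edge.
have r_inj := last_edge_inj rP; have f_inj := first_edge_inj fP.
have [r' rK r'K] : bijective r by apply: inj_card_bij; rewrite // !card_ord mN.
have s_id : r' \o f =1 id.
  apply: inj_geq_id => [|i /=]; first exact: inj_comp (can_inj r'K) f_inj.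
  have [_] := rP (r' (f i)); rewrite r'K; apply=> //.
  by have [] := fP i.
have single (i j : 'I_N) : S (r i) j -> j = i.
  move=> Sj; apply/val_inj/anti_leq.
  have [_ /(_ j (ltn_ord j) Sj) ji] := rP i.
  have [_ /(_ j (ltn_ord j))] := fP i.
  by rewrite -[f i]r'K [r' (f i)]s_id => /(_ Sj) ij; rewrite ji ij.
have cr_inj : injective (c \o r).
  move=> i j /= cE; apply/eqP/negPn/negP => ij.
  have [t [u [ctu [ti _] [uj _]]]] := sepS (ltn_ord i) (ltn_ord j) ij.
  have tE : t = r i by rewrite -[t]r'K in ti *; rewrite (single _ _ ti).
  have uE : u = r j by rewrite -[u]r'K in uj *; rewrite (single _ _ uj).
  by rewrite tE uE cE eqxx in ctu.
by have := leq_card _ cr_inj; rewrite card_ord.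
Qed.

End Separating.

Lemma has_RSPS_leq k m : 1 < N -> has_RSPS k G m -> N <= m.
Proof.
move=> N2 [P /is_RSPSP [c sep]]; apply: leq_card_separating N2 _ sep.
by move=> t i l j; apply: gpath_edges_convex.
Qed.

Lemma has_RSPS_tight k : 1 < N -> has_RSPS k G N -> N <= k.
Proof.
move=> N2 [P /is_RSPSP [c sep]]; rewrite -[k]card_ord.
apply: separating_tight N2 _ sep _ => //.
by move=> t i l j; apply: gpath_edges_convex.
Qed.

(** * Constructions *)

Lemma has_RSPS_single_edges k : N <= k -> has_RSPS k G N.
Proof.
move=> Nk; have aN (i : 'I_N) : i + 1 <= N by rewrite addn1.
exists [tuple interval_gpath (aN i) | i < N].
apply/is_RSPSP; exists (widen_ord Nk) => i j iN jN ij.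
exists (Ordinal iN), (Ordinal jN).
by rewrite -val_eqE !tnth_mktuple !pedge_in_interval //=; split; lia.
Qed.

(** The path at vertex [v] consists of the edges [v - 1] and [v]; the first
    and the last vertex have one edge only. *)
Lemma has_RSPS_stars k : 2 < k -> has_RSPS k G N.+1.
Proof.
move=> k3; have aN (v : 'I_N.+1) : v.-1 + (minn v.+1 N - v.-1) <= N.
  by have := ltn_ord v; lia.
have ck v : v %% 3 < k by apply: leq_trans k3; rewrite ltn_mod.
exists [tuple interval_gpath (aN v) | v < N.+1].
apply/is_RSPSP; exists (fun v => Ordinal (ck v)) => i j iN jN ij.
(* It remains to choose an endpoint [u] of edge [i] and an endpoint [v] of
   edge [j], of different colors and not shared by the two edges. *)
suff [u [v [uN vN cuv [ui uj] [vj vi]]]] : exists u v,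
    [/\ u < N.+1, v < N.+1, u %% 3 != v %% 3,
        (u == i \/ u == i.+1) /\ (u != j /\ u != j.+1)
      & (v == j \/ v == j.+1) /\ (v != i /\ v != i.+1)].
  exists (Ordinal uN), (Ordinal vN).
  by rewrite -val_eqE !tnth_mktuple !pedge_in_interval //=; split; lia.
have [E|nE] := eqVneq j i.+1; first by exists i, j.+1; split; lia.
have [E'|nE'] := eqVneq i j.+1; first by exists i.+1, j; split; lia.
have [E|ne] := eqVneq (i %% 3) (j %% 3).
  by exists i.+1, j; split; lia.
by exists i, j; split; lia.
Qed.

End PathGraph.

Lemma rainbow_sepnumE k (k2 : 1 < k) (G : sgraph) m : has_RSPS k G m ->
  (forall m', has_RSPS k G m' -> m <= m') -> rainbow_sepnum k2 G = m.
Proof.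
move=> has_m min_m; rewrite /rainbow_sepnum.
case: ex_minnP => m' /asboolP has_m' min_m'.
by apply/anti_leq; rewrite min_m // min_m' //; apply/asboolP.
Qed.

(* n = 2 is excluded: P_2 has a single edge, so the empty system is vacuously
   a k-RSPS and c_k(P_2) = 0. *)
Theorem theorem3p1 (k : nat) (hk : 3 <= k) (n : nat) (hn : 0 < n) (hn2 : n <> 2) :
  (n <= k + 1 -> rainbow_sepnum (ltnW hk) (path_graph n) = n - 1) /\
  (k + 1 < n -> rainbow_sepnum (ltnW hk) (path_graph n) = n).
Proof.
case: n hn hn2 => // N _ N1; rewrite subn1 /=; split=> hN.
  apply: rainbow_sepnumE => [|m]; first by apply: has_RSPS_single_edges; lia.
  case: N N1 {hN} => // N N1; apply: has_RSPS_leq; lia.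
have N2 : 1 < N by lia.
apply: rainbow_sepnumE => [|m has_m]; first exact: has_RSPS_stars.
rewrite ltn_neqAle (has_RSPS_leq N2 has_m) andbT.
by apply/eqP => E; move: has_m; rewrite -E => /(has_RSPS_tight N2); lia.
Qed.
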